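(* Suppose $T$ codes finite sets of tuples. Let $A \subset C \subset \mathcal{M}$ with $A$ small, $A = \operatorname{dcl}(A)$, $C = \operatorname{dcl}(C)$, and $C$ a normal extension of $A$; let $G := \operatorname{Aut}(C/A)$. Then the maps $H \mapsto \operatorname{Fix}(H)$ (from subgroups $H \le G$) and $B \mapsto \operatorname{Fix}(B)$ (from definably closed sets $B$ with $A \subset B \subset C$) are mutually inverse bijections between the set of subgroups of $G$ and the set of definably closed $B$ with $A \subset B \subset C$.
   Context: Fix a first-order theory $T$ in a language $L$ and a sufficiently saturated model $\mathcal{M}$ of $T$ ($\kappa$-saturated for a large cardinal $\kappa$); a subset of $\mathcal{M}$ is small if it has cardinality $<\kappa$, and all tuples are finite. For small $A$, a tuple $b$ is in $\operatorname{acl}(A)$ if it is one of finitely many solutions in $\mathcal{M}$ of some formula with parameters from $A$, and in $\operatorname{dcl}(A)$ if it is the unique solution of such a formula; $X$ is definably closed if $\operatorname{dcl}(X) = X$. $\mathcal{O}(b/A)$ denotes the orbit of $b$ under the group of automorphisms of $\mathcal{M}$ fixing $A$ pointwise. For $A \subset B \subset \mathcal{M}$, $\operatorname{Aut}(B/A)$ is the group of partial elementary maps from $B$ onto $B$ fixing $A$ pointwise. $B$ is a finite extension of $A$ if there is a tuple $b$ of elements of $B \cap \operatorname{acl}(A)$ with $B \subset \operatorname{dcl}(A \cup \{b\})$; $B$ is a normal extension of $A$ if it is a finite extension of $A$ and $\mathcal{O}(c/A) \subset B$ for every tuple $c$ of elements of $B$. With $G = \operatorname{Aut}(C/A)$: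 for a subgroup $H \le G$, $\operatorname{Fix}(H) := \{c \in C : h(c) = c \text{ for all } h \in H\}$; for $A \subset B \subset C$, $\operatorname{Fix}(B) := \{h \in G : h(b) = b \text{ for all } b \in B\}$. $T$ codes finite sets of tuples if for every $n \in \mathbb{N}$ and every finite $F \subset \mathcal{M}^n$ there is a tuple $b$ in $\mathcal{M}$ such that for every automorphism $\sigma$ of $\mathcal{M}$, $\sigma(b) = b$ if and only if $\sigma(F) = F$.
   Formalization: ''Sufficiently saturated'' is taken to mean κ-saturated and also strongly κ-homogeneous (elementary maps from small subsets of M into M extend to automorphisms of M); with κ-saturation alone, as literally stated, the correspondence can fail. *)

(* Defs.v *)
From HB Require Import structures.
From mathcomp Require Import all_boot.
From mathcomp Require Import boolp classical_sets functions cardinality.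

Set Implicit Arguments.
Unset Strict Implicit.
Unset Printing Implicit Defensive.

Local Open Scope classical_set_scope.
Local Open Scope card_scope.

Record language := Language {
  fsym : Type;
  rsym : Type;
  farity : fsym -> nat;
  rarity : rsym -> nat
}.

(* A formula over [V] has its free variables in the type [V]; [fforall] binds
   the variable [None]. *)
Inductive term (L : language) (V : Type) : Type :=
| tvar of V
| tapp (f : fsym L) of ('I_(farity f) -> term L V).

Inductive formula (L : language) (V : Type) : Type :=
| ffalse
| feq of term L V & term L V
| frel (r : rsym L) of ('I_(rarity r) -> term L V)
| fimp of formula L V & formula L V
| fforall of formula L (option V).

Arguments ffalse {L V}.

Definition sentence (L : language) := formula L void.

Record structure (L : language) := Structure {
  carrier :> Type;
  finterp : forall f : fsym L, ('I_(farity f) -> carrier) -> carrier;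
  rinterp : forall r : rsym L, ('I_(rarity r) -> carrier) -> Prop
}.

Arguments finterp {L M} f _ : rename.
Arguments rinterp {L M} r _ : rename.

Section Satisfaction.
Variables (L : language) (M : structure L).

Fixpoint eval (V : Type) (v : V -> M) (t : term L V) : M :=
  match t with
  | tvar x => v x
  | tapp f ts => finterp f (fun i => eval v (ts i))
  end.

Fixpoint sat (V : Type) (v : V -> M) (phi : formula L V) : Prop :=
  match phi with
  | ffalse => False
  | feq t u => eval v t = eval v u
  | frel r ts => rinterp r (fun i => eval v (ts i))
  | fimp phi psi => sat v phi -> sat v psi
  | fforall phi => forall x : M, sat (oapp v x) phi
  end.

Definition models (T : set (sentence L)) : Prop :=
  forall phi, T phi -> sat (of_void M) phi.

Definition is_automorphism (s : M -> M) : Prop :=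
  [/\ bijective s,
      forall f (x : 'I_(farity f) -> M), s (finterp f x) = finterp f (s \o x)
    & forall r (x : 'I_(rarity r) -> M), rinterp r x <-> rinterp r (s \o x)].

Definition elementary (B : set M) (f : B -> M) : Prop :=
  forall n (phi : formula L 'I_n) (b : 'I_n -> B),
    sat (val \o b) phi <-> sat (f \o b) phi.

(* A formula in the variables ['I_n] with parameters from [A] is a formula over
   ['I_n + A]; an n-tuple of elements of [M] is a function ['I_n -> M]. *)
Definition pformula (A : set M) (n : nat) := formula L ('I_n + A)%type.

Definition solutions (A : set M) n (phi : pformula A n) : set ('I_n -> M) :=
  [set b | sat (fun v => match v with inl i => b i | inr a => val a end) phi].

Definition tuple_acl (A : set M) n (b : 'I_n -> M) : Prop :=
  exists phi : pformula A n, finite_set (solutions phi) /\ solutions phi b.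

Definition tuple_dcl (A : set M) n (b : 'I_n -> M) : Prop :=
  exists phi : pformula A n, solutions phi = [set b].

Definition acl (A : set M) : set M :=
  [set x | tuple_acl A (fun _ : 'I_1 => x)].

Definition dcl (A : set M) : set M :=
  [set x | tuple_dcl A (fun _ : 'I_1 => x)].

Definition orbit (A : set M) n (b : 'I_n -> M) : set ('I_n -> M) :=
  [set c | exists s, [/\ is_automorphism s, forall a, A a -> s a = a
                       & c = s \o b]].

Definition finite_extension (A B : set M) : Prop :=
  A `<=` B /\
  exists n (b : 'I_n -> M),
    range b `<=` B `&` acl A /\ B `<=` dcl (A `|` range b).

Definition normal_extension (A B : set M) : Prop :=
  finite_extension A B /\
  forall n (c : 'I_n -> M), range c `<=` B ->
    forall d, orbit A c d -> range d `<=` B.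

Definition codes_finite_sets : Prop :=
  forall n (F : set ('I_n -> M)), finite_set F ->
    exists m (b : 'I_m -> M), forall s, is_automorphism s ->
      (s \o b = b <-> [set s \o c | c in F] = F).

(* The cardinal kappa is represented by a type [K] of that cardinality. *)
Definition small (K : Type) (A : set M) : Prop :=
  A #<= [set: K] /\ ~ ([set: K] #<= A).

Definition saturated (K : Type) : Prop :=
  forall A : set M, small K A ->
    forall n (p : set (pformula A n)),
      (forall q, finite_set q -> q `<=` p ->
         exists b, forall phi, q phi -> solutions phi b) ->
      exists b, forall phi, p phi -> solutions phi b.

Definition strongly_homogeneous (K : Type) : Prop :=
  forall A : set M, small K A ->
    forall f : A -> M, elementary f ->
      exists2 s, is_automorphism s & forall a : A, s (val a) = f a.

(* The usual conventions on a monster model: kappa-saturation alone does not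
   make elements of the same type over a small set conjugate under
   automorphisms. *)
Definition sufficiently_saturated (K : Type) : Prop :=
  [/\ infinite_set [set: K], saturated K & strongly_homogeneous K].

Definition is_aut (A B : set M) (g : B -> B) : Prop :=
  [/\ elementary (val \o g),
      forall y, exists x, g x = y
    & forall x : B, A (val x) -> g x = x].

Record Aut (A B : set M) := MkAut {
  aut_fun :> B -> B;
  autP : is_aut A aut_fun
}.

End Satisfaction.

Arguments Aut {L M} A B.

Section AutGroup.
Variables (L : language) (M : structure L) (A B : set M).
Implicit Types g h k : Aut A B.

HB.instance Definition _ := gen_eqMixin (Aut A B).
HB.instance Definition _ := gen_choiceMixin (Aut A B).

Lemma aut_ext g h : (forall x, g x = h x) -> g = h.
Proof.
case: g h => [g gP] [h hP] /= gh.
have {}gh : g = h by apply/funext.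
by case: _ / gh hP => hP; congr MkAut; exact: Prop_irrelevance.
Qed.

Lemma aut_inj g : injective g.
Proof.
case: g => g [/= el _ _] x y gxy.
pose phi : formula L 'I_2 := feq (tvar L ord0) (tvar L ord_max).
pose b (i : 'I_2) := if i == ord0 then x else y.
apply: val_inj; apply/(el 2 phi b).
by rewrite /= /b /= gxy.
Qed.

Fact aut_one_subproof : is_aut A (@id B).
Proof. by split=> // y; exists y. Qed.

Fact aut_mul_subproof g h : is_aut A (g \o h).
Proof.
case: g h => [g [eg sg fg]] [h [eh sh fh]]; split=> /=.
- move=> n phi b; rewrite (eh n phi b); exact: (eg n phi (h \o b)).
- by move=> z; have [y <-] := sg z; have [x <-] := sh y; exists x.
- by move=> x Ax; rewrite /= fh// fg.
Qed.

Fact aut_inv_subproof g : exists h, cancel g h /\ cancel h g.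
Proof.
have gi := @aut_inj g; case: g gi => g [eg sg fg] /= gi.
have [h gh] : {h : B -> B | cancel h g}.
  by exists (fun y => sval (cid (sg y))) => y; case: cid.
have hg : cancel g h by move=> x; apply: gi; rewrite gh.
suff hP : is_aut A h by exists (MkAut hP).
split=> [n phi b|x|x Ax].
- have := eg n phi (h \o b).
  have -> : (val \o g) \o (h \o b) = val \o b.
    by apply/funext => i /=; rewrite gh.
  by move=> e; exact: iff_sym.
- by exists (g x).
- by rewrite -[in LHS](fg _ Ax) hg.
Qed.

Definition aut_one : Aut A B := MkAut aut_one_subproof.
Definition aut_mul g h : Aut A B := MkAut (aut_mul_subproof g h).
Definition aut_inv g : Aut A B := sval (cid (aut_inv_subproof g)).

Fact aut_mulA : associative aut_mul.
Proof. by move=> g h k; exact: aut_ext. Qed.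

Fact aut_mul1g : left_id aut_one aut_mul.
Proof. by move=> g; exact: aut_ext. Qed.

Fact aut_mulg1 : right_id aut_one aut_mul.
Proof. by move=> g; exact: aut_ext. Qed.

Fact aut_mulVg : left_inverse aut_one aut_inv aut_mul.
Proof.
move=> g; apply: aut_ext => x.
by rewrite /= /aut_inv; case: cid => h /= [gh _]; rewrite gh.
Qed.

Fact aut_mulgV : right_inverse aut_one aut_inv aut_mul.
Proof.
move=> g; apply: aut_ext => x.
by rewrite /= /aut_inv; case: cid => h /= [_ hg]; rewrite hg.
Qed.

HB.instance Definition _ := isGroup.Build (Aut A B)
  aut_mulA aut_mul1g aut_mulg1 aut_mulVg aut_mulgV.

End AutGroup.

Section Correspondence.
Variables (L : language) (M : structure L) (A C : set M).

Definition is_subgroup (H : set (Aut A C)) : Prop :=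
  group_closed [pred g : Aut A C | g \in H].

Definition is_intermediate (B : set M) : Prop :=
  [/\ B = dcl B, A `<=` B & B `<=` C].

Definition Fix_of_subgroup (H : set (Aut A C)) : set M :=
  [set val c | c in [set c : C | forall h : Aut A C, H h -> h c = c]].

Definition Fix_of_set (B : set M) : set (Aut A C) :=
  [set h | forall c : C, B (val c) -> h c = c].

End Correspondence.

Arguments Fix_of_set {L M} A C B _.

(* Main.v *)
Require Import Defs.
From mathcomp Require Import all_boot.
From mathcomp Require Import boolp classical_sets functions cardinality.

(* Since [C] is generated over [A] by an algebraic tuple [b], every element of
   [Aut A C] extends to an automorphism of the monster (homogeneity over the
   small set [A `|` range b]), is determined by its value on [b], and by
   normality every automorphism fixing [A] restricts to [C].

   For a subgroup [H], the finite set [{h b | h in H}] has a code [d]; it lies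
   in [C] and is fixed by [H], so [g] fixing [Fix H] preserves that set, whence
   [g b = h b] for some [h] in [H] and [g = h].

   For [B] definably closed, [B] need not be small, as the language may be
   large. But [b] is algebraic over [B], so a single formula isolates its type
   over [B]; an automorphism fixing [A] and the finitely many parameters of that
   formula preserves the type of [b] over [B], hence fixes [B]. So whatever the
   pointwise stabilizer of [B] in [Aut A C] fixes is definable over these few
   parameters. *)

Set Implicit Arguments.
Unset Strict Implicit.
Unset Printing Implicit Defensive.

Local Open Scope classical_set_scope.
Local Open Scope card_scope.

(** * Cardinality and small sets *)

Lemma card_le_injP (T U : Type) (A : set T) (B : set U) :
  A #<= B <-> exists f : A -> B, injective f.
Proof.
split=> [/card_leP/unsquash f|[f f_inj]].
  by exists f => x y; apply: inj; rewrite inE.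
by apply/card_leP/injfunPex; exists f => // x y _ _; exact: f_inj.
Qed.

Lemma card_leT_injP (T U : Type) (A : set T) :
  A #<= [set: U] <-> exists f : A -> U, injective f.
Proof.
split=> [/card_le_injP[f f_inj]|[f f_inj]].
  by exists (val \o f); apply: inj_comp f_inj; exact: val_inj.
apply/card_le_injP; exists (fun a => exist _ (f a) (in_setT _)).
by move=> x y [] /f_inj.
Qed.

Lemma card_geT_injP (T U : Type) (A : set T) :
  [set: U] #<= A <-> exists f : U -> A, injective f.
Proof.
split=> [/card_le_injP[f f_inj]|[f f_inj]].
  by exists (fun u => f (exist _ u (in_setT _))) => x y /f_inj [].
by apply/card_le_injP; exists (f \o val); apply: inj_comp val_inj.
Qed.

(** Hilbert's hotel: a copy of [nat] inside [K] is shifted by one while everything else stays in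
    place, which frees [e 0]. *)
Lemma infinite_shift (K : Type) : infinite_set [set: K] ->
  exists (s : K -> K) (k : K), injective s /\ forall x, s x <> k.
Proof.
move/infiniteP/card_geT_injP => [e' e'_inj]; pose e n := val (e' n).
have e_inj : injective e by move=> m n /val_inj/e'_inj.
have idx_uniq x : exists o : option nat, forall n, o = Some n <-> x = e n.
  have [[n ->]|xNe] := pselect (exists n, x = e n).
    by exists (Some n) => m; split=> [[->]//|/e_inj ->].
  by exists None => n; split=> // xe; case: xNe; exists n.
have [idx idxP] := choice idx_uniq.
exists (fun x => if idx x is Some n then e n.+1 else x), (e 0); split.
  move=> x y; case xn: (idx x) => [n|]; case ym: (idx y) => [m|] //.
  - by move/idxP: xn => ->; move/idxP: ym => -> /e_inj[->].
  - by move=> /esym/idxP; rewrite ym.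
  - by move=> /idxP; rewrite xn.
move=> x; case xn: (idx x) => [n|]; first by move/e_inj.
by move/idxP; rewrite xn.
Qed.

(** An injection of [A] into [K] followed by [s] leaves [k] free for [x]. Conversely, if [j] embeds
    [K] into the union, then [j \o s] misses [j k]; should it hit [x], that value is replaced by
    [j k], and [K] embeds into [A]. *)
Lemma small_setU1 (L : language) (M : structure L) (K : Type) (A : set M)
  (x : M) : infinite_set [set: K] -> small K A -> small K (A `|` [set x]).
Proof.
move=> /infinite_shift[s [k [s_inj sk]]] [AK KA].
have [Ax|Ax] := pselect (A x); first by rewrite setUidl// sub1set inE.
have inA (y : A `|` [set x]) : val y <> x -> val y \in A.
  by move=> yx; rewrite inE; case: (set_mem (valP y)).
split.
  have [i i_inj] := (card_leT_injP K A).1 AK; apply/card_leT_injP.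
  exists (fun y => if pselect (val y = x) is right yx
                   then s (i (exist _ (val y) (inA y yx))) else k).
  move=> y z; case: pselect => [yx|yx]; case: pselect => [zx|zx].
  - by move=> _; apply: val_inj; rewrite yx zx.
  - by move=> /esym/sk.
  - by move=> /sk.
  - by move=> /s_inj/i_inj [] /val_inj.
apply: contra_not KA => /card_geT_injP[j j_inj]; apply/card_geT_injP.
have jk t : val (j (s t)) = x -> val (j k) <> x.
  move=> tx kx; have /val_inj/j_inj/sk : val (j (s t)) = val (j k) by rewrite tx kx.
  exact.
exists (fun t => match pselect (val (j (s t)) = x) with
  | left e => exist _ (val (j k)) (inA _ (jk t e))
  | right e => exist _ (val (j (s t))) (inA _ e) end).
move=> t u; case: pselect => [tx|tx]; case: pselect => [ux|ux].
- by move=> _; apply/s_inj/j_inj/val_inj; rewrite tx ux.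
- by move=> [] /val_inj/j_inj/esym/sk.
- by move=> [] /val_inj/j_inj/sk.
- by move=> [] /val_inj/j_inj/s_inj.
Qed.

Lemma small_setU_range (L : language) (M : structure L) (K : Type) (A : set M)
  n (b : 'I_n -> M) :
  infinite_set [set: K] -> small K A -> small K (A `|` range b).
Proof.
move=> Kinf; elim: n b => [|n IHn] b sA.
  suff -> : range b = set0 by rewrite setU0.
  by apply/seteqP; split=> // x [[]].
have -> : A `|` range b = (A `|` range (b \o lift ord0)) `|` [set b ord0].
  rewrite -setUA; congr (_ `|` _); apply/seteqP; split=> [_ [i _ <-]|_ [[i _ <-]|->]].
  - by case: (unliftP ord0 i) => [j|] ->; [left; exists j | right].
  - by exists (lift ord0 i).
  - by exists ord0.
by apply: small_setU1 => //; exact: IHn.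
Qed.

Lemma finite_set_enum (T : Type) (X : set T) : finite_set X ->
  exists k (e : 'I_k -> T), X `<=` range e.
Proof.
move=> /(@finite_seqP {classic T})[s ->].
exists (size s), (tnth (in_tuple s)) => x xs.
by case/seq_tnthP: (xs : x \in s) => i ->; exists i.
Qed.

(** * Renaming of variables, finite support, conjunctions *)

Section Syntax.
Variable L : language.
Implicit Types V W : Type.

Fixpoint trename V W (r : V -> W) (t : term L V) : term L W :=
  match t with
  | tvar x => tvar L (r x)
  | tapp f ts => tapp (fun i => trename r (ts i))
  end.

Fixpoint frename V W (r : V -> W) (phi : formula L V) : formula L W :=
  match phi with
  | ffalse => ffalse
  | feq t u => feq (trename r t) (trename r u)
  | Defs.frel R ts => Defs.frel (fun i => trename r (ts i))
  | fimp phi psi => fimp (frename r phi) (frename r psi)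
  | fforall phi => fforall (frename (omap r) phi)
  end.

Lemma trename_comp U V W (r : V -> W) (s : U -> V) t :
  trename (r \o s) t = trename r (trename s t).
Proof. by elim: t => //= f ts IH; congr tapp; apply/funext. Qed.

Lemma frename_comp U V W (r : V -> W) (s : U -> V) phi :
  frename (r \o s) phi = frename r (frename s phi).
Proof.
elim: phi V W r s => //=.
- by move=> V' t u V W r s; rewrite 2!(trename_comp r s).
- by move=> V' R ts V W r s; congr Defs.frel; apply/funext => i; exact: trename_comp.
- by move=> V' phi IH1 psi IH2 V W r s; rewrite (IH1 _ _ r s) (IH2 _ _ r s).
- move=> V' phi IH V W r s; rewrite -IH; congr (fforall (frename _ _)).
  by apply/funext; case.
Qed.

Lemma term_support V (t : term L V) :
  exists (I : finType) (r : I -> V) (t' : term L I), t = trename r t'.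
Proof.
elim: t => [x|f ts IH].
  by exists unit, (fun=> x), (tvar L tt).
have {}IH i : exists p : {I : finType & ((I -> V) * term L I)%type},
    ts i = trename (projT2 p).1 (projT2 p).2.
  by have [I [r [t' ->]]] := IH i; exists (existT _ I (r, t')).
have [p pP] := choice IH.
exists {i : 'I_(farity f) & projT1 (p i)}, (fun u => (projT2 (p (tag u))).1 (tagged u)),
  (tapp (fun i => trename (Tagged (fun i => projT1 (p i))) (projT2 (p i)).2)).
congr tapp; apply/funext => i; rewrite pP; exact: trename_comp.
Qed.

(** [elementary] only tests formulas over some ['I_n]; finite support carries it to every variable
    type. The induction runs over all finite types, since these are closed under the disjoint sums
    that keep the variables of subformulas and arguments apart. *)
Lemma formula_support V (phi : formula L V) :
  exists n (r : 'I_n -> V) (psi : formula L 'I_n), phi = frename r psi.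
Proof.
suff [I [r [psi ->]]] : exists (I : finType) (r : I -> V) (psi : formula L I),
    phi = frename r psi.
  exists #|I|, (r \o enum_val), (frename enum_rank psi).
  rewrite -frename_comp; congr frename; apply/funext => i /=.
  by rewrite enum_rankK.
elim: phi => {V} [V|V t u|V R ts
  |V phi [I [r [phi' ->]]] psi [J [s [psi' ->]]]|V phi [I [r [psi ->]]]].
- by exists void, (of_void V), ffalse.
- have [I [r [t' ->]]] := term_support t; have [J [s [u' ->]]] := term_support u.
  exists (I + J)%type, (fun x => match x with inl i => r i | inr j => s j end).
  by exists (feq (trename inl t') (trename inr u')); rewrite /= -!trename_comp.
- have IH i : exists p : {I : finType & ((I -> V) * term L I)%type},
      ts i = trename (projT2 p).1 (projT2 p).2.
    by have [I [r [t' ->]]] := term_support (ts i); exists (existT _ I (r, t')).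
  have [p pP] := choice IH.
  exists {i : 'I_(rarity R) & projT1 (p i)},
    (fun u => (projT2 (p (tag u))).1 (tagged u)),
    (Defs.frel (fun i => trename (Tagged (fun i => projT1 (p i))) (projT2 (p i)).2)).
  congr Defs.frel; apply/funext => i; rewrite pP; exact: trename_comp.
- exists (I + J)%type, (fun x => match x with inl i => r i | inr j => s j end).
  by exists (fimp (frename inl phi') (frename inr psi')); rewrite /= -!frename_comp.
(* The variables that [r] sends to [None] are the bound ones: they leave the support, and [insub]
   maps them to [None]. *)
- have some_val (j : {i | isSome (r i)}) : exists v, r (val j) = Some v.
    by case: j => i /=; case: (r i) => // v _; exists v.
  have [r' r'P] := choice some_val.
  exists {i | isSome (r i)}, r', (fforall (frename insub psi)) => /=.
  rewrite -frename_comp; congr (fforall (frename _ _)); apply/funext => i /=.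
  case: insubP => [j _ <-|] /=; first by rewrite r'P.
  by case: (r i).
Qed.

Variable M : structure L.

Lemma eval_rename V W (r : V -> W) (v : W -> M) t :
  eval v (trename r t) = eval (v \o r) t.
Proof. by elim: t => //= f ts IH; congr finterp; apply/funext. Qed.

Lemma sat_rename V W (r : V -> W) (v : W -> M) phi :
  sat v (frename r phi) <-> sat (v \o r) phi.
Proof.
elim: phi W r v => {V} //=.
- by move=> V t u W r v; rewrite !eval_rename.
- move=> V R ts W r v.
  by under eq_fun do rewrite eval_rename.
- by move=> V phi IH1 psi IH2 W r v; rewrite IH1 IH2.
- move=> V phi IH W r v; split=> h x; have := h x; rewrite IH;
  by congr sat; apply/funext; case.
Qed.

Definition fnot V (phi : formula L V) := fimp phi ffalse.

Lemma conjunction V k (phi : 'I_k -> formula L V) :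
  exists theta, forall v : V -> M, sat v theta <-> forall i, sat v (phi i).
Proof.
elim: k phi => [|k IHk] phi.
  by exists (fnot ffalse) => v; split=> [_ []|_].
have [theta thetaP] := IHk (phi \o lift ord0).
exists (fnot (fimp (phi ord0) (fnot theta))) => v /=; rewrite thetaP; split.
  move=> h.
  have [h0 h1] : sat v (phi ord0) /\ forall i, sat v (phi (lift ord0 i)).
    by apply: contrapT => h'; apply: h => ? ?; apply: h'.
  by move=> i; case: (unliftP ord0 i) => [j|] ->.
by move=> h h'; apply: h' => // i; exact: h.
Qed.
End Syntax.

(** * Automorphisms, elementary maps and definable closure *)

Section Models.
Variables (L : language) (M : structure L).
Implicit Types A B C : set M.

Lemma automorphism_sat (s : M -> M) : is_automorphism s ->
  forall V (v : V -> M) phi, sat (s \o v) phi <-> sat v phi.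
Proof.
move=> [[s' sK s'K] sf sr] V v phi.
have eval_s W (w : W -> M) t : eval (s \o w) t = s (eval w t).
  by elim: t => //= f ts IH; rewrite sf; congr finterp; apply/funext.
elim: phi v => {V} //=.
- by move=> V t u v; rewrite !eval_s; split=> [/(can_inj sK)|->].
- move=> V R ts v; rewrite [X in _ <-> X]sr.
  by under eq_fun do rewrite eval_s.
- by move=> V phi IH1 psi IH2 v; rewrite IH1 IH2.
- move=> V phi IH v; have sE x : oapp (s \o v) (s x) = s \o oapp v x.
    by apply/funext; case.
  split=> h x; first by have := h (s x); rewrite sE IH.
  by rewrite -(s'K x) sE IH.
Qed.

Lemma automorphism_inv (s : M -> M) : is_automorphism s ->
  exists s', [/\ is_automorphism s', cancel s s' & cancel s' s].
Proof.
move=> saut; have [[s' sK s'K] sf sr] := saut.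
have ss' V (x : V -> M) : s \o (s' \o x) = x by apply/funext => i /=; rewrite s'K.
exists s'; split=> //; split; first by exists s.
- by move=> f x; apply: (can_inj sK); rewrite sf ss' s'K.
- by move=> r x; rewrite (sr r (s' \o x)) ss'.
Qed.

Lemma elementary_sat B (f : B -> M) : elementary f ->
  forall V (v : V -> B) phi, sat (val \o v) phi <-> sat (f \o v) phi.
Proof.
move=> f_elem V v phi; have [n [r [psi ->]]] := formula_support phi.
by rewrite !sat_rename; exact: (f_elem n psi (v \o r)).
Qed.

Definition elem A x (Ax : A x) : A := exist _ x (mem_set Ax).

Definition inclusion A B (AB : A `<=` B) (a : A) : B :=
  elem (AB _ (set_mem (valP a))).

(** Names the assignment written inline in [solutions], so that assignments can be compared as
    compositions. *)
Definition valuation A n (b : 'I_n -> M) (v : 'I_n + A) : M :=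
  match v with inl i => b i | inr a => val a end.

Lemma dclP A x : dcl A x <->
  exists phi : pformula A 1, forall y, solutions phi (fun=> y) <-> y = x.
Proof.
split=> -[phi phiP]; exists phi.
  move=> y; rewrite phiP; split=> [/= e|->//].
  by have := congr1 (@^~ ord0) e.
apply/seteqP; split=> [b|_ ->]; last exact/phiP.
have -> : b = (fun=> b ord0) by apply/funext => i; rewrite (ord1 i).
by move=> /phiP ->.
Qed.

Lemma sub_dcl A : A `<=` dcl A.
Proof.
move=> x Ax; apply/dclP.
by exists (feq (tvar L (inl ord0)) (tvar L (inr (elem Ax)))).
Qed.

Definition widen A B (AB : A `<=` B) n (phi : pformula A n) : pformula B n :=
  frename (fun v => match v with
                    | inl i => inl i
                    | inr a => inr (inclusion AB a)
                    end) phi.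

Lemma solutions_widen A B (AB : A `<=` B) n (phi : pformula A n) b :
  solutions (widen AB phi) b <-> solutions phi b.
Proof.
rewrite /solutions /= sat_rename; set v := _ \o _.
suff -> : v = valuation b by [].
by apply/funext; case.
Qed.

Lemma dcl_mono A B : A `<=` B -> dcl A `<=` dcl B.
Proof.
move=> AB x /dclP[phi phiP]; apply/dclP.
by exists (widen AB phi) => y; rewrite solutions_widen.
Qed.

Lemma tuple_acl_mono A B n (b : 'I_n -> M) :
  A `<=` B -> tuple_acl A b -> tuple_acl B b.
Proof.
move=> AB [phi [phi_fin phib]]; exists (widen AB phi).
split; last exact/solutions_widen.
by apply: sub_finite_set phi_fin => c /solutions_widen.
Qed.

(** Rigidity on generators. The formula defining [c] over [A] holds of [f c] over the moved
    parameters; pulling back by [s], it holds of the preimage of [f c], which is therefore [c]. *)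
Lemma elementary_dcl A C (f : C -> M) s : elementary f -> is_automorphism s ->
  A `<=` C -> (forall c : C, A (val c) -> s (val c) = f c) ->
  forall c : C, dcl A (val c) -> s (val c) = f c.
Proof.
move=> f_elem s_aut AC sf c /dclP[phi phiP].
have [s' [_ sK s'K]] := automorphism_inv s_aut.
pose v (x : 'I_1 + A) : C :=
  match x with inl _ => c | inr a => inclusion AC a end.
suff /phiP e : solutions phi (fun=> s' (f c)) by rewrite -e s'K.
rewrite /solutions /= -(automorphism_sat s_aut).
have -> : s \o @valuation A 1 (fun=> s' (f c)) = f \o v.
  apply/funext => -[i|a] /=; first by rewrite s'K.
  by rewrite -(sf (inclusion AC a))//=; exact: set_mem (valP a).
rewrite -(elementary_sat f_elem).
have -> : val \o v = @valuation A 1 (fun=> val c) by apply/funext; case.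
exact/phiP.
Qed.

Variable K : Type.
Hypothesis M_saturated : sufficiently_saturated M K.

(* If no formula over [A] isolates [d], saturation realizes the type of [d] over
   [A] together with [x <> d], and homogeneity moves [d] to that realization. *)
Lemma dcl_fixed A d : small K A ->
  (forall s, is_automorphism s -> (forall a, A a -> s a = a) -> s d = d) ->
  dcl A d.
Proof.
have [Kinf sat_M hom_M] := M_saturated.
move=> A_small d_fixed; apply: contrapT => d_ndcl.
pose A' := A `|` [set d].
have A'_small : small K A' by exact: small_setU1.
have AA' : A `<=` A' by left.
have A'd : A' d by right.
pose neq : pformula A' 1 :=
  fnot (feq (tvar L (inl ord0)) (tvar L (inr (elem A'd)))).
pose p : set (pformula A' 1) := [set psi | psi = neq \/
  exists2 phi : pformula A 1, solutions phi (fun=> d) & psi = widen AA' phi].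
have [|e ep] := sat_M A' A'_small 1 p.
  move=> q /finite_set_enum[k [enum q_enum]] qp.
  (* Each listed formula is traced back to one over [A] true of [d]. The true formula serves as
     filler for [neq] and for listed formulas outside [q]. *)
  have lift_A j : exists phi : pformula A 1, solutions phi (fun=> d) /\
      (q (enum j) -> enum j = neq \/ enum j = widen AA' phi).
    have [/qp[->|[phi phid ->]]|nq] := pselect (q (enum j)).
    - by exists (fnot ffalse); split=> //; left.
    - by exists phi; split=> //; right.
    - by exists (fnot ffalse); split=> // -[].
  have [phi phiP] := choice lift_A.
  have [theta thetaP] := conjunction M phi.
  (* [theta] holds of [d] but cannot define it, so it has a second solution. *)
  have [y y_sol y_d] : exists2 y, solutions theta (fun=> y) & y <> d.
    apply: contrapT => no_y; apply: d_ndcl; apply/dclP; exists theta => y.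
    split=> [y_sol|->]; first by apply: contrapT => yd; apply: no_y; exists y.
    by apply/thetaP => j; have [] := phiP j.
  exists (fun=> y) => psi q_psi; have [j _ jpsi] := q_enum _ q_psi.
  rewrite -jpsi in q_psi *.
  have [_ /(_ q_psi)[->|->]] := phiP j; first by move=> /= /y_d.
  by apply/solutions_widen; move/thetaP: y_sol; exact.
have e_d : e ord0 <> d by have := ep _ (or_introl erefl).
have type_e phi : solutions phi (fun=> d) -> sat (@valuation A 1 e) phi.
  by move=> phid; apply/(solutions_widen AA')/ep; right; exists phi.
(* Applied to negations, the inclusion of types becomes an equality. *)
have type_eE phi : sat (@valuation A 1 (fun=> d)) phi <-> sat (@valuation A 1 e) phi.
  split; first exact: type_e.
  by move=> ephi; apply: contrapT => /(type_e (fnot phi)); apply.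
pose f (x : A') : M := if pselect (val x = d) then e ord0 else val x.
have f_elem : elementary f.
  move=> n phi b.
  (* Every point of [A'] is the variable or a parameter from [A], so elementarity of [f] reduces to
     the equality of the types of [d] and [e] over [A]. *)
  have loc i : exists v : 'I_1 + A, valuation (fun=> d) v = val (b i) /\
      valuation e v = f (b i).
    rewrite /f; case: pselect => bd; first by exists (inl ord0).
    have Ab : A (val (b i)) by case: (set_mem (valP (b i))).
    by exists (inr (elem Ab)).
  have [v vP] := choice loc.
  have -> : val \o b = @valuation A 1 (fun=> d) \o v.
    by apply/funext => i; have [] := vP i.
  have -> : f \o b = @valuation A 1 e \o v.
    by apply/funext => i; have [] := vP i.
  by rewrite -!sat_rename.
have [s s_aut sf] := hom_M A' A'_small f f_elem.
apply: e_d; have := sf (elem A'd).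
rewrite /f /=; case: pselect => //= _ <-.
apply: d_fixed => // a Aa; have := sf (inclusion AA' (elem Aa)).
rewrite /f /=; case: pselect => //= ad _.
by case: d_ndcl; rewrite -ad; exact: sub_dcl.
Qed.

End Models.

Lemma small_sub (L : language) (M : structure L) (K : Type) (A B : set M) :
  A `<=` B -> small K B -> small K A.
Proof.
move=> /subset_card_le AB [BK KB]; split; first exact: card_le_trans AB BK.
by apply: contra_not KB => /card_le_trans; apply.
Qed.

(** * Algebraic tuples and isolated types *)

Section Algebraic.
Variables (L : language) (M : structure L).
Implicit Types A B C : set M.

(** The conjunction of the formulas for the coordinates has its solutions in a product of finite
    sets, here the image of [F]. *)
Lemma tuple_acl_range A n (b : 'I_n -> M) : range b `<=` acl A -> tuple_acl A b.
Proof.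
move=> bA; have b_acl i := bA _ (imageT b i).
have [phi phiP] := choice b_acl.
pose r i (v : 'I_1 + A) : 'I_n + A :=
  match v with inl _ => inl i | inr a => inr a end.
have satE c i : sat (valuation c) (frename (r i) (phi i)) <->
    solutions (phi i) (fun=> c i).
  rewrite sat_rename; set v := _ \o _.
  suff -> : v = valuation (fun=> c i) by [].
  by apply/funext; case.
have [theta thetaP] := conjunction M (fun i => frename (r i) (phi i)).
exists theta; split; last first.
  by apply/thetaP => i; apply/satE; have [] := phiP i.
have enum_sol i : exists e : {k & 'I_k -> 'I_1 -> M},
    solutions (phi i) `<=` range (projT2 e).
  by have [/finite_set_enum[k [e eP]] _] := phiP i; exists (existT _ k e).
have [e eP] := choice enum_sol.
pose F (u : {dffun forall i, 'I_(projT1 (e i))}) i := projT2 (e i) (u i) ord0.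
apply: (@sub_finite_set _ _ (range F)); last first.
  exact/finite_image/finite_finset.
move=> c /thetaP c_sol.
have {}c_sol i : exists u, projT2 (e i) u = (fun=> c i).
  by have /satE/eP[u _ uc] := c_sol i; exists u.
exists (finfun (fun i => sval (cid (c_sol i)))) => //.
by apply/funext => i; rewrite /F ffunE; case: cid => u /= ->.
Qed.

(** Among the finitely many solutions of an algebraic formula for [b], each one not realizing the
    type of [b] is excluded by a formula true of [b]; the conjunction of all these isolates the
    type. *)
Lemma algebraic_type_isolated B n (b : 'I_n -> M) : tuple_acl B b ->
  exists2 theta : pformula B n, solutions theta b &
    forall c, solutions theta c ->
    forall phi : pformula B n, solutions phi b -> solutions phi c.
Proof.
move=> [phi0 [/finite_set_enum[k [e eP]] phi0b]].
have separate j : exists phi : pformula B n, solutions phi b /\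
    (solutions phi (e j) -> forall psi : pformula B n,
     solutions psi b -> solutions psi (e j)).
  have [jP|/existsNP[psi]] := pselect (forall psi : pformula B n,
     solutions psi b -> solutions psi (e j)).
    by exists phi0.
  by move=> /not_implyP[psib psij]; exists psi.
have [phi phiP] := choice separate.
have [theta thetaP] := conjunction M (fun j => oapp phi phi0 (unlift ord0 j)).
exists theta.
  by apply/thetaP => j; case: unliftP => [i|] _ //=; have [] := phiP i.
move=> c /thetaP c_sol.
have [j _ jc] : range e c by apply: eP; have := c_sol ord0; rewrite unlift_none.
rewrite -jc in c_sol *; have [_] := phiP j; apply.
by have := c_sol (lift ord0 j); rewrite liftK.
Qed.

End Algebraic.

(** * The Galois correspondence *)

Section Correspondence.
Variables (L : language) (M : structure L) (A C : set M).

Lemma autKV (g : Aut A C) c : g ((g^-1)%g c) = c.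
Proof. exact: (congr1 (fun h : Aut A C => h c) (mulgV g)). Qed.

Lemma aut_elementary (g : Aut A C) : elementary (val \o g).
Proof. by case: g => ? []. Qed.

Lemma aut_fixes (g : Aut A C) c : A (val c) -> g c = c.
Proof. by case: g => ? [? ?]; apply. Qed.

Lemma elementary_val (B : set M) : elementary (val : B -> M).
Proof. by []. Qed.

Lemma Fix_of_set_subgroup B : is_subgroup (Fix_of_set A C B).
Proof.
split; first by rewrite inE.
move=> g h; rewrite !inE => gB hB c Bc /=.
have hc : (h^-1)%g c = c by apply: (@aut_inj _ _ _ _ h); rewrite autKV hB.
rewrite -[RHS](gB c Bc); exact: congr1.
Qed.

(** Each [h] in [H] agrees with the identity automorphism on the fixed set, hence on its definable
    closure, which stays inside [C]. *)
Lemma Fix_of_subgroup_intermediate (H : set (Aut A C)) :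
  A `<=` C -> C = dcl C -> is_intermediate A C (Fix_of_subgroup H).
Proof.
move=> AC C_closed.
have FC : Fix_of_subgroup H `<=` C by move=> _ [c _ <-]; exact: set_mem (valP c).
split=> //; last first.
  by move=> a Aa; exists (elem (AC _ Aa)) => // h _; exact: aut_fixes.
apply/seteqP; split; first exact: sub_dcl.
move=> x x_dcl; have Cx : C x by rewrite C_closed; exact: dcl_mono FC x x_dcl.
exists (elem Cx) => // h Hh; apply: val_inj; apply/esym.
apply: (@elementary_dcl _ _ (Fix_of_subgroup H) C (val \o h) id) => //.
- exact: aut_elementary.
- by split=> //; exists id.
- by move=> c [c' c'H /val_inj <-] /=; rewrite c'H.
Qed.

Variable K : Type.
Hypothesis M_saturated : sufficiently_saturated M K.
Hypothesis A_small : small K A.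
Hypothesis C_normal : normal_extension A C.

Let AC : A `<=` C := C_normal.1.1.

Lemma automorphism_restrict s : is_automorphism s -> (forall a, A a -> s a = a) ->
  exists g : Aut A C, forall c, val (g c) = s (val c).
Proof.
(* Normality for 1-tuples. It is used for [s] and for its inverse, the latter giving surjectivity of
   the restriction. *)
have stable t : is_automorphism t -> (forall a, A a -> t a = a) ->
    forall c : C, C (t (val c)).
  move=> t_aut tA c; have [_ /(_ 1 (fun=> val c))] := C_normal.
  have cC : range (fun _ : 'I_1 => val c) `<=` C.
    by move=> _ [_ _ <-]; exact: set_mem (valP c).
  move=> /(_ cC (fun=> t (val c))); apply; last by exists ord0.
  by exists t.
move=> s_aut sA; have [s' [s'_aut sK s'K]] := automorphism_inv s_aut.
have s'A a : A a -> s' a = a by move=> Aa; rewrite -{1}(sA a Aa).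
pose g c : C := elem (stable s s_aut sA c).
suff gP : is_aut A g by exists (MkAut gP).
split.
- move=> n phi v.
  by have := automorphism_sat s_aut (val \o v) phi; exact: iff_sym.
- move=> c; exists (elem (stable s' s'_aut s'A c)).
  by apply: val_inj; exact: s'K.
- by move=> c Ac; apply: val_inj => /=; rewrite sA.
Qed.

Lemma normal_extension_generators : exists n (b : 'I_n -> M),
  [/\ range b `<=` C, tuple_acl A b, C `<=` dcl (A `|` range b)
    & small K (A `|` range b)].
Proof.
have [[_ [n [b [bP bC]]]] _] := C_normal; exists n, b; split=> //.
- by move=> x /bP[].
- by apply: tuple_acl_range => x /bP[].
- by have [? _ _] := M_saturated; exact: small_setU_range.
Qed.

(** [C] is not assumed small, so homogeneity is applied on [A] and [b] only; agreement then spreads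
    to [C] by rigidity. *)
Lemma aut_extend (g : Aut A C) :
  exists2 s, is_automorphism s & forall c, s (val c) = val (g c).
Proof.
have [n [b [bC _ Cb b_small]]] := normal_extension_generators.
have [_ _ hom_M] := M_saturated.
have AbC : A `|` range b `<=` C by rewrite subUset.
have [|s s_aut sg] := hom_M _ b_small (val \o g \o inclusion AbC).
  by move=> m phi v; rewrite -(elementary_sat (aut_elementary g)).
exists s => // c.
apply: (elementary_dcl (aut_elementary g) s_aut AbC); last exact/Cb/set_mem/valP.
move=> c' Abc'; rewrite -[val c']/(val (elem Abc')) sg /=.
by congr (val (g _)); exact: val_inj.
Qed.

Lemma Fix_of_set_K B : is_intermediate A C B ->
  Fix_of_subgroup (Fix_of_set A C B) = B.
Proof.
move=> [B_closed AB BC]; apply/seteqP; split; last first.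
  by move=> x Bx; exists (elem (BC _ Bx)) => // g; exact.
move=> _ [c c_fixed <-].
have [n [b [bC b_acl Cb b_small]]] := normal_extension_generators.
have AbC : A `|` range b `<=` C by rewrite subUset.
have [theta theta_b theta_isol] :=
  algebraic_type_isolated (tuple_acl_mono AB b_acl).
have [k [r [psi thetaE]]] := formula_support theta.
(* [A] with the parameters of [theta] that occur in [psi]. Since [r] may also hit coordinates of
   [b], the intersection drops those outside [B]. *)
pose B0 := (A `|` range (valuation b \o r)) `&` B.
have B0_small : small K B0.
  apply: (@small_sub _ _ _ _ (A `|` range (valuation b \o r))).
    by move=> x [].
  by have [? _ _] := M_saturated; exact: small_setU_range.
rewrite B_closed; apply: (@dcl_mono _ _ B0) => [x []//|].
apply: (dcl_fixed M_saturated B0_small) => s s_aut sB0.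
have sA a : A a -> s a = a by move=> Aa; apply: sB0; split; [left | exact: AB].
have theta_sb : solutions theta (s \o b).
  move: theta_b; rewrite thetaE /solutions /= !sat_rename.
  rewrite -(automorphism_sat s_aut).
  suff -> : s \o (valuation b \o r) = valuation (s \o b) \o r by [].
  apply/funext => i /=; case ri: (r i) => [j|x] //=.
  apply: sB0; split; last exact: set_mem (valP x).
  by right; exists i => //=; rewrite ri.
(* [chi] defines [x] from [A] and [b]. Read as a property of [b] with parameter [x] in [B], it
   belongs to the type of [b] over [B], so it also holds of [s \o b]; applying the inverse of [s]
   shows that [x] is fixed. *)
have sB x : B x -> s x = x.
  move=> Bx; have /dclP[chi chiP] := Cb _ (BC _ Bx).
  have loc (a : A `|` range b) : exists v : 'I_n + B,
      valuation b v = val a /\ valuation (s \o b) v = s (val a).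
    have [Aa|[i _ ia]] := set_mem (valP a).
      by exists (inr (elem (AB _ Aa))) => /=; rewrite sA.
    by exists (inl i); rewrite /= ia.
  have [p pP] := choice loc.
  pose q (v : 'I_1 + (A `|` range b)) : 'I_n + B :=
    match v with inl _ => inr (elem Bx) | inr a => p a end.
  have [s' [_ sK s'K]] := automorphism_inv s_aut.
  suff /chiP e : solutions chi (fun=> s' x) by rewrite -{1}e s'K.
  rewrite /solutions /= -(automorphism_sat s_aut).
  have -> : s \o @valuation _ _ (A `|` range b) 1 (fun=> s' x) =
      valuation (s \o b) \o q.
    apply/funext => -[i|a] /=; first by rewrite s'K.
    by have [] := pP a.
  rewrite -sat_rename; apply: (theta_isol _ theta_sb).
  rewrite /solutions /= sat_rename.
  suff -> : @valuation _ _ B n b \o q = @valuation _ _ (A `|` range b) 1 (fun=> x).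
    exact/chiP.
  by apply/funext => -[i|a] //=; have [] := pP a.
(* The restriction of [s] to [C] fixes [B] pointwise, hence fixes [c]. *)
have [g gs] := automorphism_restrict s_aut sA.
rewrite -gs; congr val; apply: c_fixed => x Bx.
by apply: val_inj; rewrite gs; exact: sB.
Qed.

Hypothesis T_codes : codes_finite_sets M.
Hypothesis C_closed : C = dcl C.

Lemma Fix_of_subgroup_K (H : set (Aut A C)) : is_subgroup H ->
  Fix_of_set A C (Fix_of_subgroup H) = H.
Proof.
move=> [H1 HV]; have {}H1 : H 1%g by move: H1; rewrite inE.
have {}HV g h : H g -> H h -> H (g / h)%g.
  by move=> Hg Hh; have := HV g h; rewrite !inE; exact.
have HVg g : H g -> H (g^-1)%g by move=> Hg; rewrite -div1g; exact: HV.
have HM g h : H g -> H h -> H (g * h)%g.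
  by move=> Hg Hh; rewrite -[h]invgK; apply: HV => //; exact: HVg.
apply/seteqP; split; last first.
  by move=> h Hh c [c' c'H /val_inj <-]; exact: c'H.
move=> g g_fixes.
have [n [b [bC [phi [phi_fin phi_b]] Cb b_small]]] := normal_extension_generators.
have AbC : A `|` range b `<=` C by rewrite subUset.
pose bC' i : C := elem (bC _ (imageT b i)).
pose tr (h : Aut A C) i := val (h (bC' i)).
(* The orbit of [b] under [H], finite because elements of [Aut A C] preserve [phi]. *)
pose F := tr @` H.
have F_fin : finite_set F.
  apply: sub_finite_set phi_fin => _ [h _ <-].
  pose v (x : 'I_n + A) : C :=
    match x with inl i => bC' i | inr a => inclusion AC a end.
  change (sat (valuation (tr h)) phi).
  have vb : val \o v = valuation b by apply/funext; case.
  suff <- : val \o h \o v = valuation (tr h).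
    by apply: (elementary_sat (aut_elementary h) v phi).1; rewrite vb.
  apply/funext => -[i|a] //=; rewrite aut_fixes//.
  exact: set_mem (valP a).
have [m [d dP]] := T_codes F_fin.
(* An automorphism fixing [A] and [b] fixes [C] pointwise, hence every tuple in [F], hence the code
   [d]. *)
have dC j : C (d j).
  rewrite C_closed; apply: (dcl_mono AbC).
  apply: (dcl_fixed M_saturated b_small) => s s_aut s_fixes.
  have sC (c : C) : s (val c) = val c.
    apply: (elementary_dcl (@elementary_val C) s_aut AbC).
      by move=> c' /s_fixes.
    exact/Cb/set_mem/valP.
  have strE h : s \o tr h = tr h by apply/funext => i; exact: sC.
  suff /(dP s s_aut) /(congr1 (@^~ j)) : [set s \o c | c in F] = F by [].
  apply/seteqP; split=> [_ [_ [h Hh <-] <-]|_ [h Hh <-]].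
    by rewrite strE; exists h.
  by exists (tr h); [exists h | exact: strE].
have trM s (h h' : Aut A C) : (forall c, s (val c) = val (h c)) -> s \o tr h' = tr (h * h')%g.
  by move=> sh; apply/funext => i; exact: sh.
(* Left translation by [h] permutes [H], so the extension of [h] preserves [F] and fixes its
   code. *)
have dH j : Fix_of_subgroup H (d j).
  exists (elem (dC j)) => // h Hh; apply: val_inj.
  have [s s_aut sh] := aut_extend h; rewrite -sh /=.
  suff /(dP s s_aut) /(congr1 (@^~ j)) : [set s \o c | c in F] = F by [].
  apply/seteqP; split=> [_ [_ [h' Hh' <-] <-]|_ [h' Hh' <-]].
    by rewrite (trM _ h)//; exists (h * h')%g => //; exact: HM.
  exists (tr (h^-1 * h')%g); first by exists (h^-1 * h')%g => //; apply/HM/Hh'/HVg.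
  by rewrite (trM _ h)// mulVKg.
have [s s_aut sg] := aut_extend g.
have sd : s \o d = d.
  by apply/funext => j; have := sg (elem (dC j)); rewrite g_fixes; last exact: dH.
(* As [s] fixes the code, it preserves [F]; the image of [tr 1], that is of [b], is then [tr h] for
   some [h] in [H]. *)
have [h Hh hg] : F (tr g).
  move/(dP s s_aut): sd => <-; exists (tr 1%g); first by exists 1%g.
  by rewrite (trM _ g)// mulg1.
suff -> : g = h by [].
apply: aut_ext => c; apply: val_inj; rewrite -sg.
apply: (elementary_dcl (aut_elementary h) s_aut AbC); last exact/Cb/set_mem/valP.
move=> c' [Ac'|[i _ ic']]; rewrite sg /=; first by rewrite !aut_fixes.
have -> : c' = bC' i by exact: val_inj.
by have := congr1 (@^~ i) hg.
Qed.

End Correspondence.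

Theorem theorem12 (L : language) (T : set (sentence L)) (K : Type)
    (M : structure L)
    (M_models_T : models M T)
    (M_saturated : sufficiently_saturated M K)
    (T_codes : codes_finite_sets M)
    (A C : set M)
    (AC : A `<=` C)
    (A_small : small K A)
    (A_closed : A = dcl A)
    (C_closed : C = dcl C)
    (C_normal : normal_extension A C) :
  let subgroups : set (set (Aut A C)) := [set H | is_subgroup H] in
  let intermediate : set (set M) := [set B | is_intermediate A C B] in
  [/\ set_bij subgroups intermediate (@Fix_of_subgroup L M A C),
      set_bij intermediate subgroups (Fix_of_set A C),
      forall H, subgroups H -> Fix_of_set A C (Fix_of_subgroup H) = H
    & forall B, intermediate B -> Fix_of_subgroup (Fix_of_set A C B) = B].
Proof.
move=> subgroups intermediate.
have fixS H : subgroups H -> intermediate (Fix_of_subgroup H).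
  by move=> _; exact: Fix_of_subgroup_intermediate.
have fixB B : intermediate B -> subgroups (Fix_of_set A C B).
  by move=> _; exact: Fix_of_set_subgroup.
have fixSK H : subgroups H -> Fix_of_set A C (Fix_of_subgroup H) = H.
  exact: (Fix_of_subgroup_K M_saturated A_small C_normal T_codes C_closed).
have fixBK B : intermediate B -> Fix_of_subgroup (Fix_of_set A C B) = B.
  exact: (Fix_of_set_K M_saturated A_small C_normal).
split=> //; split=> //.
- move=> H H'; rewrite !inE => HS H'S e.
  by rewrite -(fixSK H HS) e fixSK.
- by move=> B Bi; exists (Fix_of_set A C B); [exact: fixB | exact: fixBK].
- move=> B B'; rewrite !inE => BI B'I e.
  by rewrite -(fixBK B BI) e fixBK.
- by move=> H HS; exists (Fix_of_subgroup H); [exact: fixS | exact: fixSK].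
Qed.
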